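(* Let $p$ be an odd prime, let $\alpha \ge \beta$ be positive integers, let $A=\{a\in\mathbb{N} : 1\le a\le p^{\alpha},\ \gcd(a,p)=1\}$, and let $S$ be a sequence over the group $\mathbb{Z}_{p^\alpha}\oplus\mathbb{Z}_{p^\beta}$ with $|S| = \alpha + \beta$. If $S$ has no $A$-weighted zero-sum subsequence of length $n$ for any $1\le n\leq p^{\alpha}$, then $\delta_j(S) \ge 1$ for all $j \in \{1,\dots,\alpha\}$, and $\sum_{j=1}^{\alpha} \delta_j(S) = \alpha + \beta$.
   Context: $\mathbb{Z}_n$ denotes the cyclic group $\mathbb{Z}/n\mathbb{Z}$. A sequence over a finite abelian group $G$ (written additively) is a finite list of elements of $G$, repetitions allowed, order irrelevant; $|S|$ denotes the length (number of terms) of $S$, and a subsequence is obtained by choosing a subset of the indices. A sequence $x_1\cdots x_k$ over $G$ is an $A$-weighted zero-sum sequence of length $k$ if there exist $u_1,\dots,u_k\in A$ (not necessarily distinct) with $u_1x_1+\cdots+u_kx_k=0$ in $G$. For a sequence $S$ over $\mathbb{Z}_{p^\alpha}\oplus\mathbb{Z}_{p^\beta}$, $\delta_j(S)$ denotes the number of terms of $S$, counted with multiplicity, whose order in the group is $p^j$. *)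

(* Defs.v *)
From mathcomp Require Import all_boot all_order all_algebra all_fingroup.

Set Implicit Arguments.
Unset Strict Implicit.
Unset Printing Implicit Defensive.

Import GRing.Theory.
Local Open Scope ring_scope.

(* Weights are natural numbers acting by [x *+ u]. Sequences over a group are
   lists; everything below is invariant under permutation of the list. *)
Definition weighted_zero_sum (G : zmodType) (A : pred nat) (T : seq G) : Prop :=
  exists u : seq nat,
    [/\ size u = size T, all A u & \sum_(xu <- zip T u) xu.1 *+ xu.2 = 0].

Definition has_weighted_zero_sum_subseq (G : zmodType) (A : pred nat)
    (S : seq G) (n : nat) : Prop :=
  exists T : seq G, [/\ subseq T S, size T = n & weighted_zero_sum A T].

Definition weights (p a : nat) : pred nat :=
  [pred x : nat | (1 <= x <= p ^ a)%N && (gcdn x p == 1%N)].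

(* ['Z_n] is Z/nZ only for [n > 1], which holds for [p ^ a] and [p ^ b] when [p]
   is prime and [a], [b] are positive. The group law underlying the order [#[x]]
   is the addition, see [mulg_ZpZpE]. *)
Definition delta (p a b j : nat) (S : seq ('Z_(p ^ a) * 'Z_(p ^ b))) : nat :=
  count (fun x => #[x]%g == (p ^ j)%N) S.

Lemma mulg_ZpZpE (p a b : nat) (x y : 'Z_(p ^ a) * 'Z_(p ^ b)) :
  (x * y)%g = x + y.
Proof. by []. Qed.

(* Main.v *)
(* A sequence x_1, ..., x_l without zero-sums with weights prime to p has
   pairwise distinct sums c_1 x_1 + ... + c_l x_l for digits 0 <= c_i < p, because
   differences of digits are 0 or prime to p; hence a subgroup K contains at most
   log_p |K| of the x_i. Here a + b <= p^a, so S is such a sequence, and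
   l = a + b means that the sums run over the whole group. Summing a nontrivial
   character chi over the group then gives a vanishing product of geometric
   sums, so chi(x_i) has order exactly p for some i.

   Suppose no x_i has order p^j. Take H maximal among the subgroups of exponent
   dividing p^(j-1) containing at least log_p |H| of the x_i. If some x_i had
   order p in the quotient Q by H, then adding x_i to H would contradict
   maximality. If none has, let W be the p-torsion of Q: among the |Q|(1 - 1/|W|)
   characters of Q nontrivial on W, an x_i of order p^k, k >= 2, accounts for
   |Q|(p - 1)p^(-k)(1 - p/|W|) of them, while at most 2m of the x_i outside H have
   order at most p^m in Q. As |W| is p or p^2 and p >= 3, not all characters
   are accounted for. *)

Require Import Defs.
From mathcomp Require Import all_boot all_order all_algebra all_fingroup.
From mathcomp Require Import all_solvable all_field all_character.
From mathcomp Require Import zify ring.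

Set Implicit Arguments.
Unset Strict Implicit.
Unset Printing Implicit Defensive.

Import GRing.Theory.
Local Open Scope group_scope.

(** * Counting lemmas for characters and exponents *)

(** Characters with [K] in their kernel are those of [G / K], lifted by [mod_Iirr]. *)
Lemma card_Iirr_cfker (gT : finGroupType) (G K : {group gT}) :
  abelian G -> K \subset G ->
  (#|[set i : Iirr G | K \subset cfker ('chi_i)%R]| * #|K| = #|G|)%N.
Proof.
move=> abG sKG; have nKG : K <| G by rewrite -sub_abelian_normal.
rewrite cardsE -(on_card_preimset (mod_Iirr_bij nKG)) cardsE.
rewrite (eq_card (B := predT)); last first.
  by move=> i; rewrite !inE unfold_in mod_IirrE // cfker_mod.
rewrite card_Iirr_abelian ?quotient_abelian //.
by rewrite card_quotient ?normal_norm // mulnC Lagrange.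
Qed.

(* The constant [4 * p - 2] makes this an equality at [M = 0]. *)
Lemma sum_expn_bound (p : nat) (I : finType) (k : I -> nat) :
  1 < p -> (forall m, 1 < m -> #|[set i | 1 < k i <= m]| <= m.*2) ->
  forall M, (p.-1 * (\sum_(i | 1 < k i <= M.+2) p ^ (M.+2 - k i) + M.+2.*2) + 2
      <= (4 * p - 2) * p ^ M + p.-1 * #|[set i | (1 < k i <= M.+2)%N]|)%N.
Proof.
(* The extreme case has four indices with [k i = 2] and two for each larger value. Carrying the
   slack of the count below [M.+2.*2] makes the induction close. *)
move=> p1 hN; elim=> [|M IH].
  rewrite (eq_bigr (fun=> 1%N)); last first.
    by move=> i /andP[k1 k2]; rewrite (_ : k i = 2) //; apply/eqP; rewrite eqn_leq k1 k2.
  rewrite sum1dep_card expn0; lia.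
(* Raising [M] multiplies the old terms by [p]; each new index has [k i = M.+3] and contributes
   1. *)
have sumS : (\sum_(i | 1 < k i <= M.+3) p ^ (M.+3 - k i)
    + #|[set i | (1 < k i <= M.+2)%N]|
  = p * \sum_(i | 1 < k i <= M.+2) p ^ (M.+2 - k i) + #|[set i | (1 < k i <= M.+3)%N]|)%N.
  rewrite -!sum1dep_card.
  rewrite (bigID (fun i => k i <= M.+2)%N) /=.
  rewrite [in RHS](bigID (fun i => k i <= M.+2)%N (fun i => 1 < k i <= M.+3)%N) /=.
  rewrite big_distrr /=.
  rewrite (eq_bigl (fun i => 1 < k i <= M.+2)%N); last by move=> i; lia.
  rewrite [X in _ = (_ + (X + _))%N](eq_bigl (fun i => 1 < k i <= M.+2)%N);
    last by move=> i; lia.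
  rewrite [X in (_ + X + _ = _)%N](eq_bigr (fun=> 1%N)); last first.
    move=> i /andP[/andP[_ h1]]; rewrite -ltnNge => h2.
    by rewrite (_ : k i = M.+3) ?subnn //; apply/eqP; rewrite eqn_leq h1 h2.
  rewrite (eq_bigr (fun i => p * p ^ (M.+2 - k i))%N); first by lia.
  by move=> i /andP[_ h]; rewrite -expnS subSn.
have := hN M.+2 isT; have := hN M.+3 isT; move: sumS IH; rewrite expnS.
set f := (\sum_(i | _) _)%N; set g := (\sum_(i | _) _)%N.
set N := #|_|; set N' := #|_|; set q := (p ^ M)%N.
move=> sumS IH h3 h2; clearbody f g N N' q.
case: p p1 sumS IH => // p p1 /= sumS IH.
have hp : (p * N <= p * (M.+2).*2)%N by rewrite leq_mul2l h2 orbT.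
have : (p.+1 * (p * (g + M.+2.*2) + 2) <= p.+1 * ((4 * p.+1 - 2) * q + p * N))%N.
  by rewrite leq_mul2l IH orbT.
have hf : (p * (f + N) = p * (p.+1 * g + N'))%N by rewrite sumS.
have hp2 : (p * (p * N) <= p * (p * (M.+2).*2))%N by rewrite leq_mul2l hp orbT.
nia.
Qed.

(** This is nX = g/(pq) - g/(p^2 q) - g/(wq) + g/(wpq), with denominators cleared and negative terms
    moved across. *)
Lemma inclusion_exclusion_arith (nX e nB nBC p q w g : nat) :
  ((nX + e + nB) * (p * q) = g)%N -> (nB * (p * (p * q)) = g)%N ->
  ((e + nBC) * (w * q) = g)%N -> (nBC * (w * (p * q)) = g)%N ->
  (nX * (w * (p * (p * q))) + g * (w + p * p) = g * (p * w + p))%N.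
Proof.
move=> hA hB hAC hBC.
have -> : (g * (w + p * p) = w * (nB * (p * (p * q))) + p * p * ((e + nBC) * (w * q)))%N.
  by rewrite hB hAC mulnDr !(mulnC g).
have -> : (g * (p * w + p) = p * w * ((nX + e + nB) * (p * q))
                             + p * (nBC * (w * (p * q))))%N.
  by rewrite hA hBC mulnDr !(mulnC g).
ring.
Qed.

Lemma card_bigcup_le (I T : finType) (P : pred I) (F : I -> {set T}) :
  #|\bigcup_(i | P i) F i| <= \sum_(i | P i) #|F i|.
Proof.
elim/big_rec2: _ => [|i n A _ leA]; first by rewrite cards0.
by apply: leq_trans (leq_card_setU _ _) _; rewrite leq_add2l.
Qed.

(** * Characters covered by elements of given order *)

Section CoverCount.
Variables (gT : finGroupType) (p : nat) (G : {group gT}).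
Hypotheses (p_pr : prime p) (abG : abelian G) (pG : p.-group G).

Let W := Group (group_Ldiv p abG).

(** [<[y]>] is a nontrivial cyclic [p]-group, so it meets [W] in its only subgroup of order [p]. *)
Lemma card_Ldiv_cycle (y : gT) (j : nat) : y \in G -> #[y] = (p ^ j.+1)%N ->
  (#|W <*> <[y]>| = #|W| * p ^ j)%N.
Proof.
move=> yG oy; have sWG : W \subset G by exact: subsetIl.
have syG : <[y]> \subset G by rewrite cycle_subG.
have cWy : <[y]> \subset 'N(W).
  exact: subset_trans syG (sub_abelian_norm abG sWG).
rewrite norm_joinEr //.
have pr0 := prime_gt0 p_pr.
apply/eqP; rewrite -(eqn_pmul2r pr0); apply/eqP.
have := mul_cardG W <[y]>.
suff -> : #|W :&: <[y]>| = p.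
  move=> <-; rewrite -[#|<[y]>|]/#[y] oy expnSr; lia.
have py : p.-group <[y]> by apply: pgroupS pG.
have y1 : <[y]> != 1.
  by rewrite -cardG_gt1 -[#|_|]/#[y] oy -(exp1n j.+1) ltn_exp2r // prime_gt1.
rewrite -(Ohm1_cyclic_pgroup_prime (cycle_cyclic y) py y1).
have e1 := OhmE 1 py.
have ab : abelian <[y]> by exact: cycle_abelian.
rewrite e1 expn1 (_ : <<_>> = Group (group_Ldiv p ab)) ?genGid //=; last first.
  by rewrite (genGid (Group (group_Ldiv p ab))).
apply: eq_card => z; rewrite !inE.
have [zy|_] := boolP (z \in <[y]>); last by rewrite andbF.
by rewrite (subsetP syG) ?andbT.
Qed.

(** Inclusion-exclusion over the characters whose kernel contains [x ^+ p], [x], or either one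
    together with [W]. *)
Lemma card_Iirr_order_p (x : gT) (k : nat) : x \in G -> #[x] = (p ^ k)%N -> 1 < k ->
  (#|[set i : Iirr G | [&& x \notin cfker ('chi_i)%R, x ^+ p \in cfker ('chi_i)%R
                          & ~~ ('Ldiv_p(G) \subset cfker ('chi_i)%R)]]|
     * (#|'Ldiv_p(G)| * p ^ k) + #|G| * (#|'Ldiv_p(G)| + p * p)
   = #|G| * (p * #|'Ldiv_p(G)| + p))%N.
Proof.
move=> xG ox; case: k ox => [|[|k]] ox // _.
have sWG : W \subset G by exact: subsetIl.
have oxp : #[x ^+ p] = (p ^ k.+1)%N.
  by rewrite orderXdiv ox ?expnS ?mulKn ?dvdn_mulr ?prime_gt0.
have xpG : x ^+ p \in G by rewrite groupX.
have sxG : <[x]> \subset G by rewrite cycle_subG.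
have sxpG : <[x ^+ p]> \subset G by rewrite cycle_subG.
have [jx jxp] : W <*> <[x]> \subset G /\ W <*> <[x ^+ p]> \subset G.
  by rewrite !join_subG sWG sxG sxpG.
have hA := card_Iirr_cfker abG sxpG.
have hB := card_Iirr_cfker abG sxG.
have hAC := card_Iirr_cfker abG jxp.
have hBC := card_Iirr_cfker abG jx.
rewrite (card_Ldiv_cycle xpG oxp) in hAC.
rewrite (card_Ldiv_cycle xG ox) in hBC.
rewrite -[#|<[_]>|]/#[_] oxp in hA.
rewrite -[#|<[_]>|]/#[_] ox in hB.
move: hA hB hAC hBC.
set A := [set i | _]; set B := [set i | _]; set AC := [set i | _].
set BC := [set i | _]; set X := [set i | _] => hA hB hAC hBC.
have sBA : B \subset A.
  apply/subsetP=> i; rewrite ![i \in _]in_set !cycle_subG => xi; exact: groupX.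
have cBC : BC \subset AC.
  apply/subsetP=> i; rewrite ![i \in _]in_set !join_subG !cycle_subG => /andP[-> xi].
  exact: groupX.
have eX : X = (A :\: B) :\: (AC :\: BC).
  apply/setP=> i; rewrite !in_setD ![i \in _]in_set !join_subG !cycle_subG /=.
  by case: (x \in _); case: (_ ^+ _ \in _); case: (_ \subset _).
have sub : AC :\: BC \subset A :\: B.
  apply/subsetP=> i; rewrite !in_setD ![i \in _]in_set !join_subG !cycle_subG /=.
  by case: (x \in _); case: (_ ^+ _ \in _); case: (_ \subset _).
have := cardsD (A :\: B) (AC :\: BC); rewrite -eX (setIidPr sub).
have := subset_leq_card sub.
have := cardsD A B; rewrite (setIidPr sBA).
have := subset_leq_card sBA.
have := cardsD AC BC; rewrite (setIidPr cBC).
have := subset_leq_card cBC.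
rewrite -[#|'Ldiv_p(G)|]/#|W|.
move: hA hB hAC hBC; rewrite !expnS.
set q := (p ^ k)%N; set w := #|W|; set g := #|G|.
move: #|X| #|A :\: B| #|AC :\: BC| #|A| #|B| #|AC| #|BC|.
clearbody q w g; move=> nX d e nA nB nAC nBC hA hB hAC hBC i1 e1 i2 e2 i3 e3.
have {}e1 : nAC = (e + nBC)%N by rewrite e1 subnK.
have {}e2 : nA = (d + nB)%N by rewrite e2 subnK.
have {}e3 : d = (nX + e)%N by rewrite e3 subnK.
subst nAC nA d.
exact: inclusion_exclusion_arith hA hB hAC hBC.
Qed.

(* A case of Hajos's theorem on factorizations of abelian groups, with the
   factorization replaced by its consequence for characters. *)
Lemma cover_order_p (I : finType) (x : I -> gT) :
  odd p -> G :!=: 1 -> #|'Ldiv_p(G)| <= p ^ 2 -> (forall i, x i \in G) ->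
  (forall m, #|[set i | (x i != 1) && (x i ^+ (p ^ m) == 1)]| <= m.*2) ->
  (forall j : Iirr G, j != 0%R ->
     exists i, x i \notin cfker ('chi_j)%R /\ x i ^+ p \in cfker ('chi_j)%R) ->
  exists i, #[x i] = p.
Proof.
move=> p_odd ntG leW xG hN cover.
have p1 := prime_gt1 p_pr; have p3 := odd_prime_gt2 p_odd p_pr.
case: (pickP (fun i => #[x i] == p)) => [i /eqP<-|no_p]; first by exists i.
exfalso.
pose k i := logn p #[x i].
have ok i : #[x i] = (p ^ k i)%N.
  by rewrite [LHS](card_pgroup (mem_p_elt pG (xG i))).
have k1 i : k i != 1%N.
  by apply/negP=> /eqP ki; have := no_p i; rewrite ok ki expn1 eqxx.
pose M := logn p #|G|.
have kM i : k i <= M.+2.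
  by apply: leqW; apply: leqW; apply: dvdn_leq_log; rewrite ?cardG_gt0 ?order_dvdG.
have hN' m : 1 < m -> #|[set i | 1 < k i <= m]| <= m.*2.
  move=> _; apply: leq_trans (hN m); apply: subset_leq_card.
  apply/subsetP=> i; rewrite !inE => /andP[ki1 kim].
  rewrite -order_dvdn ok dvdn_exp2l // andbT -order_gt1 ok.
  by rewrite -(expn0 p) ltn_exp2l //; apply: ltnW.
have := sum_expn_bound p1 hN' M; rewrite (eq_bigl (fun i => 1 < k i)); last first.
  by move=> i; rewrite kM andbT.
have := hN' M.+2 isT; set N := #|_|; set f := (\sum_(i | _) _)%N => leN lef.
have sWG : W \subset G by exact: subsetIl.
have hW := card_Iirr_cfker abG sWG.
have hX := cardsC [set i : Iirr G | W \subset cfker ('chi_i)%R].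
rewrite card_Iirr_abelian // in hX.
have w_gt0 : 0 < #|W| by exact: cardG_gt0.
(* A covering [x i] lies outside the kernel, so [k i] is not 0; it is not 1 by [no_p]. *)
have leX : (#|~: [set i : Iirr G | W \subset cfker ('chi_i)%R]| <=
  \sum_(i | 1 < k i) #|[set j : Iirr G | [&& x i \notin cfker ('chi_j)%R,
      x i ^+ p \in cfker ('chi_j)%R & ~~ (W \subset cfker ('chi_j)%R)]]|)%N.
  apply: leq_trans (card_bigcup_le _ _).
  apply: subset_leq_card; apply/subsetP=> j; rewrite in_setC ![j \in _]in_set => nWj.
  have [|i [xi xpi]] := cover j.
    by apply: contraNneq nWj => ->; rewrite cfker_irr0.
  apply/bigcupP; exists i; last by rewrite [j \in _]in_set xi xpi nWj.
  have : k i != 0%N.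
    apply: contraNneq xi => ki; have := ok i; rewrite ki => /eqP.
    by rewrite order_eq1 => /eqP->; exact: group1.
  by move: (k1 i); case: (k i) => [|[]].
have card_i i : 1 < k i -> (#|[set j : Iirr G | [&& x i \notin cfker ('chi_j)%R,
      x i ^+ p \in cfker ('chi_j)%R & ~~ (W \subset cfker ('chi_j)%R)]]| * (#|W| * p ^ k i)
    = #|G| * (p * #|W| + p - (#|W| + p * p)))%N.
  by move=> ki; have := card_Iirr_order_p (xG i) (ok i) ki; rewrite mulnBr => <-; rewrite addnK.
(* The factor [p ^ M.+2] turns each reciprocal of [p ^ k i] into an integer. *)
have leXf : (#|~: [set i : Iirr G | W \subset cfker ('chi_i)%R]| * (#|W| * p ^ M.+2)
    <= #|G| * (p * #|W| + p - (#|W| + p * p)) * f)%N.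
  apply: leq_trans (leq_mul leX (leqnn _)) _.
  rewrite big_distrl big_distrr /=; apply: leq_sum => i ki.
  by rewrite -(card_i i ki) -!mulnA -expnD subnKC ?kM.
have [w ew] : exists w, #|W| = (p ^ w)%N.
  by exists (logn p #|W|); apply: card_pgroup; apply: pgroupS sWG pG.
have w_bounds : 0 < w <= 2.
  apply/andP; split; last by rewrite -(leq_exp2l _ _ p1) -ew.
  have [_ pdvd _] := pgroup_pdiv pG ntG.
  have [y yG oy] := Cauchy p_pr pdvd.
  rewrite -(ltn_exp2l _ _ p1) expn0 -ew cardG_gt1; apply/trivgPn; exists y.
    by rewrite !inE yG -order_dvdn oy /=.
  by rewrite -order_gt1 oy.
have g_gt0 : 0 < #|G| by exact: cardG_gt0.
(* The characters nontrivial on [W] number |G|(1 - 1/|W|); |G| cancels. *)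
have {}leXf : ((#|W| - 1) * p ^ M.+2
    <= (p * #|W| + p - (#|W| + p * p)) * f)%N.
  rewrite -(leq_pmul2l g_gt0) !mulnA; apply: leq_trans leXf.
  rewrite !mulnA leq_mul2r; apply/orP; right.
  by rewrite mulnBr muln1 -{1}hX mulnDl hW addKn.
have q_gt0 : 0 < p ^ M by rewrite expn_gt0 (ltnW p1).
have {lef} : (p.-1 * f + 2 <= (4 * p - 2) * p ^ M)%N.
  have : (p.-1 * N <= p.-1 * (M.+2).*2)%N by rewrite leq_mul2l leN orbT.
  by move: lef; rewrite mulnDr; lia.
move: leXf; rewrite ew !expnS; move: (p ^ M)%N q_gt0 f => q q_gt0 f.
clear -p3 w_bounds q_gt0; case: p p3 => // r r_gt1 /=.
case: w w_bounds => [|[|[|]]] // _.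
  (* If |W| = p, the right-hand coefficient vanishes while the left side is positive. *)
  by rewrite expn1 addnC subnn mul0n leqn0 !muln_eq0; lia.
(* If |W| = p^2 and p = r + 1, then (r+2)(r+1)q <= rf and rf + 2 <= (4r+2)q, which is impossible. *)
rewrite -mulnn => le1 le2.
have eD : (r.+1 * (r.+1 * r.+1) + r.+1 - (r.+1 * r.+1 + r.+1 * r.+1) = r.+1 * r * r)%N.
  by apply/eqP; rewrite -(eqn_add2r (r.+1 * r.+1 + r.+1 * r.+1)) subnK; [apply/eqP; ring | nia].
have eP : ((r.+1 * r.+1 - 1) * (r.+1 * (r.+1 * q)) = r.+1 * r * (r.+2 * r.+1 * q))%N.
  by rewrite (_ : r.+1 * r.+1 - 1 = r * r.+2)%N; [ring | lia].
have : (r.+1 * r * (r.+2 * r.+1 * q) <= r.+1 * r * (r * f))%N.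
  by rewrite -eP [X in _ <= X]mulnA -eD.
have r_gt0 : 0 < r by lia.
rewrite leq_pmul2l ?muln_gt0 ?r_gt0 //.
move: le2; rewrite (_ : 4 * r.+1 - 2 = 4 * r + 2)%N; last by lia.
have : (2 * (r * q) <= r * (r * q))%N by rewrite leq_mul2r -ltnS r_gt1 orbT.
nia.
Qed.
End CoverCount.

(** * Products with digit exponents, and the maximal subgroup argument *)

Section Digits.
Variables (gT : finGroupType) (p n : nat) (I : finType) (x : I -> gT).
Hypotheses (p_pr : prime p) (abT : abelian [set: gT]).
Hypotheses (n_gt0 : 0 < n) (pn : p %| n) (xn : forall i, x i ^+ n = 1).
(** Weight 0 leaves [x i] out, so [u] encodes both a subsequence and its weights. *)
Hypothesis x_free : forall u : I -> nat,
  (forall i, (u i == 0) || (u i < n) && coprime (u i) p) ->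
  \prod_i x i ^+ u i = 1 -> forall i, u i = 0.

Let mulgC (y z : gT) : y * z = z * y.
Proof. by apply: (centsP abT); rewrite inE. Qed.

Lemma prodg_mul (F E : I -> gT) : \prod_i (F i * E i) = (\prod_i F i) * (\prod_i E i).
Proof.
elim/big_rec3: _ => [|i y z t _ ->]; first by rewrite mulg1.
by rewrite -!mulgA; congr (_ * _); rewrite !mulgA (mulgC z).
Qed.

Definition digit_prod (c : {ffun I -> 'I_p}) := \prod_i x i ^+ c i.

Lemma digit_prod_inj : injective digit_prod.
Proof.
move=> c d ecd; apply/ffunP=> i; apply/val_inj => /=.
have le_pn : p <= n by exact: dvdn_leq.
have ltn (e : {ffun I -> 'I_p}) k : e k < n by apply: leq_trans le_pn.
(* [n - d k] stands for minus [d k], as [x k ^+ n = 1]; since [p] divides [n], reduction mod [n]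
   keeps the class mod [p]. *)
pose u k := (c k + (n - d k)) %% n.
have u_mod k : u k = (c k + (n - d k)) %[mod p] by rewrite modn_dvdm.
have eq_digit k : p %| u k -> c k = d k :> nat.
  rewrite /dvdn u_mod => /eqP dv.
  have : c k + (n - d k) + d k = d k %[mod p] by rewrite -modnDml dv.
  by rewrite -addnA subnK ?(ltnW (ltn _ _)) // -modnDmr (eqP pn) addn0 !modn_small.
have u0 k : c k = d k :> nat -> u k = 0.
  by move=> e; rewrite /u e subnKC ?modnn // ltnW.
have uP k : (u k == 0) || (u k < n) && coprime (u k) p.
  rewrite ltn_pmod //= coprime_sym prime_coprime //.
  by have [/eq_digit/u0->|] := boolP (p %| u k); rewrite ?eqxx ?orbT.
apply: eq_digit; rewrite (x_free uP) //.
apply: (mulIg (digit_prod d)); rewrite mul1g -{2}ecd -prodg_mul.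
apply: eq_bigr => k _; rewrite expg_mod // -expgD -addnA subnK ?(ltnW (ltn _ _)) //.
by rewrite expgD xn mulg1.
Qed.

(** Digit vectors supported on the indices with [x i] in [K] inject into [K]. *)
Lemma card_free_in (K : {group gT}) : p ^ #|[set i | x i \in K]| <= #|K|.
Proof.
pose o := Ordinal (prime_gt0 p_pr).
rewrite -{1}(card_ord p) -(card_pffun_on o [set i | x i \in K] 'I_p).
rewrite -(card_imset _ digit_prod_inj); apply: subset_leq_card.
apply/subsetP=> _ /imsetP[c /pffun_onP[/subsetP cK _] ->].
apply: group_prod => i _; have [->|ci] := eqVneq (c i) o; first exact: group1.
by apply: groupX; have := cK i ci; rewrite inE.
Qed.

Lemma free_cover (j : Iirr [set: gT]) : #|gT| = (p ^ #|I|)%N -> j != 0%R ->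
  exists i, x i \notin cfker ('chi_j)%R /\ x i ^+ p \in cfker ('chi_j)%R.
Proof.
move=> cardT nz_j; set chi := ('chi_j)%R.
have lin_chi : chi \is a linear_char by exact: (char_abelianP _ abT).
have sum0 : (\sum_(g : gT) chi g = 0)%R.
  have := cfdot_irr j 0%R; rewrite (negPf nz_j) cfdotE irr0.
  move/eqP; rewrite mulf_eq0 invr_eq0 (negPf (neq0CG _)) /=.
  move/eqP=> s0; rewrite -[RHS]s0; apply: eq_big => g; first by rewrite inE.
  by rewrite cfun1E inE Num.Theory.conjC1 mulr1.
have chi_prod (c : {ffun I -> 'I_p}) : (chi (digit_prod c) = \prod_i chi (x i) ^+ c i)%R.
  rewrite /digit_prod (big_morph chi (id1 := 1%R) (op1 := *%R)) ?lin_char1 //; last first.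
    by move=> y z; rewrite lin_charM ?inE.
  by apply: eq_bigr => i _; rewrite lin_charX ?inE.
(* By cardinality [digit_prod] is a bijection, so the sum of [chi] over the group factors. *)
have : (\prod_i \sum_(k < p) chi (x i) ^+ k = 0)%R.
  rewrite bigA_distr_bigA /= -[RHS]sum0.
  rewrite [RHS](reindex digit_prod) /=; first by apply: eq_bigr => c _; rewrite chi_prod.
  apply: onW_bij; apply: inj_card_bij digit_prod_inj _.
  by rewrite card_ffun card_ord cardT.
move/eqP/prodf_eq0 => [i _ /eqP s0]; exists i.
(* A vanishing geometric sum forces chi(x i)^p = 1; the value chi(x i) = 1 would make the sum p. *)
have xp : (chi (x i) ^+ p = 1)%R by apply/eqP; rewrite -subr_eq0 subrX1 s0 mulr0.
rewrite !cfkerEchar ?lin_charW // !inE -/chi lin_char1 //= lin_charX ?inE // xp eqxx; split=> //.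
apply/eqP=> x1; move/eqP: s0; rewrite x1 (eq_bigr (fun=> 1%R)) => [|k _]; last by rewrite expr1n.
by rewrite sumr_const card_ord Num.Theory.pnatr_eq0 eqn0Ngt prime_gt0.
Qed.
(** Each nonempty fibre of the power map is a translate of the [q]-torsion. *)
Lemma card_power_preim (H : {group gT}) (q : nat) :
  #|[set g | g ^+ q \in H]| <= #|H| * #|'Ldiv_q([set: gT])|.
Proof.
rewrite -sum1_card (partition_big (fun g => g ^+ q) (mem H)) /=; last first.
  by move=> g; rewrite inE.
rewrite -sum_nat_const; apply: leq_sum => h hH; rewrite sum1dep_card.
set F := [set g | _]; have [->|[g0]] := set_0Vmem F; first by rewrite cards0.
rewrite !inE => /andP[_ /eqP g0h].
rewrite -(card_imset F (mulIg g0^-1)); apply: subset_leq_card.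
apply/subsetP=> _ /imsetP[g + ->]; rewrite !inE => /andP[_ /eqP gh].
by rewrite expgMn ?expgVn ?gh ?g0h ?mulgV ?eqxx //; exact: mulgC.
Qed.

Lemma power_preim_group_set (H : {group gT}) (q : nat) :
  group_set [set g | g ^+ q \in H].
Proof.
apply/group_setP; split=> [|g h]; rewrite !inE ?expg1n ?group1 // => gH hH.
by rewrite expgMn ?groupM //; exact: mulgC.
Qed.

Lemma free_order_exists (j : nat) :
  odd p -> #|gT| = (p ^ #|I|)%N ->
  (forall m, #|'Ldiv_(p ^ m)([set: gT])| <= p ^ m.*2) ->
  (exists g : gT, g ^+ (p ^ j) != 1) ->
  exists i, #[x i] = (p ^ j.+1)%N.
Proof.
move=> p_odd cardT leLdiv [g gj]; have p1 := prime_gt1 p_pr.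
have sT (A : {set gT}) : A \subset [set: gT] by exact: subsetT.
case: (pickP (fun i => #[x i] == p ^ j.+1)%N) => [i /eqP|no_j]; first by exists i.
exfalso.
pose J (K : {set gT}) := [set i | x i \in K].
(* [P] asks for equality in [card_free_in]; the exponent is [j] because the missing order is
   [p ^ j.+1]. *)
pose P (H : {group gT}) := (#|H| <= p ^ #|J H|)%N && (H \subset 'Ldiv_(p ^ j)()).
have P1 : P 1%G.
  by rewrite /P cards1 expn_gt0 (ltnW p1) sub_LdivT exponent1 dvd1n.
have [H /maxgroupP[/andP[leH Hj] maxH] _] := maxgroup_exists P1.
have pT : p.-group [set: gT].
  by rewrite /pgroup cardsT cardT pnatX pnat_id.
have nH (A : {set gT}) : A \subset 'N(H).
  exact: subset_trans (sT A) (sub_abelian_norm abT (sT H)).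
have nHx y : y \in 'N(H) by rewrite -cycle_subG.
have nsH : H <| [set: gT] by rewrite /normal sT nH.
have card_preim m : (#|[set g | g ^+ (p ^ m) \in H]| <= #|H| * p ^ m.*2)%N.
  by apply: leq_trans (card_power_preim _ _) _; rewrite leq_mul2l leLdiv orbT.
have cosetX y k : coset H y ^+ k = coset H (y ^+ k) by rewrite morphX.
have coset1 y : (coset H y == 1) = (y \in H).
  by apply/eqP/idP=> [/coset_idr|/coset_id]; auto.
have abQ : abelian ([set: gT] / H) by exact: quotient_abelian.
have pQ : p.-group ([set: gT] / H) by exact: quotient_pgroup.
have [|||||i oi] := cover_order_p p_pr abQ pQ (x := fun i => coset H (x i)) p_odd.
(* [g] shows that [H], of exponent dividing [p ^ j], is proper. *)
- apply: contraNneq gj => /eqP; rewrite -subG1 quotient_sub1 // => sTH.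
  have := subsetP (subset_trans sTH Hj) g; rewrite !inE => /(_ isT); by [].
(* The [p]-torsion of the quotient lies in [K / H], and |K| <= |H| p^2. *)
- pose K := Group (power_preim_group_set H p).
  have sHK : H \subset K by apply/subsetP=> y yH; rewrite inE groupX.
  apply: (@leq_trans #|K / H|).
    apply: subset_leq_card; apply/subsetP=> _ /setIP[/morphimP[y _ _ ->]].
    by rewrite inE /= cosetX coset1 => yK; rewrite mem_morphim ?nHx // inE.
  rewrite card_quotient // -(leq_pmul2l (cardG_gt0 H)) Lagrange //.
  by have := card_preim 1%N; rewrite expn1.
- move=> i; by rewrite mem_quotient ?inE.
(* The gain from [J H] to [J K] is at most 2m, as p^|J K| <= |K| <= |H| p^(2m) <= p^(|J H| + 2m). *)
- move=> m.
  set K := Group (power_preim_group_set H (p ^ m)).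
  have sHK : J H \subset J K.
    by apply/subsetP=> i; rewrite !inE => xH; exact: groupX.
  rewrite (_ : [set i | _] = J K :\: J H); last first.
    by apply/setP=> i; rewrite !inE cosetX !coset1.
  have := cardsD (J K) (J H); rewrite (setIidPr sHK) => ->.
  rewrite leq_subLR -(leq_exp2l _ _ p1) expnD.
  apply: leq_trans (card_free_in K) _.
  by apply: leq_trans (card_preim m) _; rewrite leq_mul2r leH orbT.
- move=> k nz_k; have [|i [xi xpi]] := @free_cover (mod_Iirr k) cardT.
    by rewrite mod_Iirr_eq0.
  have kerE y : (coset H y \in cfker ('chi_k)%R) = (y \in cfker ('chi_(mod_Iirr k))%R).
    by rewrite mod_IirrE // -!cycle_subG -quotient_cycle // sub_cfker_mod.
  by exists i; rewrite cosetX !kerE.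
have xiH : x i \notin H.
  by rewrite -coset1 -order_gt1 oi.
have xpH : x i ^+ p \in H.
  by rewrite -coset1 -cosetX -oi expg_order.
(* The order of [x i] divides [p ^ j.+1], and equality is excluded by [no_j]. *)
have xij : x i ^+ (p ^ j) = 1.
  have : #[x i] %| p ^ j.+1.
    rewrite order_dvdn expnS expgM.
    by have := subsetP Hj _ xpH; rewrite inE.
  case/(dvdn_pfactor _ _ p_pr) => e; rewrite leq_eqVlt => /predU1P[->|le_e] oe.
    by have := no_j i; rewrite oe eqxx.
  by apply/eqP; rewrite -order_dvdn oe dvdn_exp2l.
have sHK : H \subset H <*> <[x i]> by exact: joing_subl.
have xK : x i \in H <*> <[x i]> by rewrite -cycle_subG joing_subr.
suff PK : P (H <*> <[x i]>)%G.
  by have := maxH _ PK sHK => eK; rewrite -eK xK in xiH.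
apply/andP; split; last first.
  pose L := Group (group_Ldiv (p ^ j) abT).
  apply: subset_trans (subsetIr [set: gT] _); rewrite -[_ :&: _]/(L : {set gT}).
  by rewrite join_subG subsetI sT Hj cycle_subG !inE xij eqxx.
(* Adjoining [x i] multiplies the order of [H] by [p] and raises the count by at least one. *)
rewrite -(Lagrange sHK) -card_quotient //= quotientYidl // quotient_cycle // -orderE oi.
apply: leq_trans (leq_mul leH (leqnn p)) _.
rewrite -expnSr leq_exp2l //.
apply: leq_trans (_ : #|i |: J H| <= _); first by rewrite cardsU1 inE xiH.
apply: subset_leq_card; apply/subsetP=> k; rewrite !inE => /predU1P[->|]; first exact: xK.
exact: (subsetP sHK).
Qed.
End Digits.

(** * Passage to ['Z_(p ^ a) * 'Z_(p ^ b)] and to sequences *)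

Lemma card_Ldiv_cyclic (gT : finGroupType) (G : {group gT}) (n : nat) :
  cyclic G -> 0 < n -> #|'Ldiv_n(G)| <= n.
Proof.
move=> cG n_gt0; have abG := cyclic_abelian cG.
pose L := Group (group_Ldiv n abG).
have cL : cyclic L by apply: cyclicS cG; exact: subsetIl.
rewrite -[#|_|]/#|L| -(exponent_cyclic cL); apply: dvdn_leq => //.
by rewrite -sub_LdivT; exact: subsetIr.
Qed.

Lemma expg_pair (gT1 gT2 : finGroupType) (y : gT1 * gT2) (n : nat) :
  y ^+ n = (y.1 ^+ n, y.2 ^+ n).
Proof. by elim: n => // n IH; rewrite !expgS IH. Qed.

Lemma card_Ldiv_Zp_pair (m n q : nat) : 0 < q ->
  #|'Ldiv_q([set: 'Z_m * 'Z_n])| <= q * q.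
Proof.
have cycZ k : cyclic [set: 'Z_k] by rewrite (Zp_cycle (Zp_trunc k).+1) cycle_cyclic.
move=> q_gt0.
apply: leq_trans (leq_mul (card_Ldiv_cyclic (cycZ m) q_gt0)
                          (card_Ldiv_cyclic (cycZ n) q_gt0)).
rewrite -cardsX; apply: subset_leq_card; apply/subsetP=> -[y z].
by rewrite !inE /= expg_pair => /eqP[-> ->]; rewrite !eqxx.
Qed.

(** With [b <= a] this keeps the length of every subsequence of [S] within the range up to
    [p ^ a]. *)
Lemma double_leq_expn (p a : nat) : 2 < p -> a.*2 <= p ^ a.
Proof.
move=> p3; elim: a => // a IH; rewrite expnS.
have : 0 < p ^ a by rewrite expn_gt0 (ltnW (ltnW p3)).
case: a IH => [|a] IH; nia.
Qed.

Lemma expg_Zp_pair (p a b : nat) (y : 'Z_(p ^ a) * 'Z_(p ^ b)) :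
  prime p -> 0 < b -> b <= a -> y ^+ (p ^ a) = 1.
Proof.
move=> p_pr b_gt0 ba; have p1 := prime_gt1 p_pr.
have gt1 c : 0 < c -> 1 < p ^ c by move=> c0; rewrite -(exp1n c) ltn_exp2r.
have expZ c (z : 'Z_(p ^ c)) : 0 < c -> c <= a -> z ^+ (p ^ a) = 1.
  move=> c_gt0 ca; apply/eqP; rewrite -order_dvdn.
  apply: dvdn_trans (order_dvdG (in_setT z)) _.
  by rewrite cardsT card_ord Zp_cast ?gt1 // dvdn_exp2l.
by rewrite expg_pair !expZ // (leq_trans b_gt0).
Qed.

Lemma weighted_zero_sum_free (p a b : nat) (S : seq ('Z_(p ^ a) * 'Z_(p ^ b))) :
  prime p -> odd p -> b <= a -> size S = (a + b)%N ->
  (forall n : nat, 1 <= n <= p ^ a ->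
       ~ has_weighted_zero_sum_subseq (weights p a) S n) ->
  forall u : 'I_(size S) -> nat,
  (forall i, (u i == 0) || (u i < p ^ a) && coprime (u i) p) ->
  \prod_(i < size S) (nth 0%R S i) ^+ u i = 1 -> forall i, u i = 0.
Proof.
move=> p_pr p_odd ba sS hzs u uP prod1 i; apply/eqP; apply: contraT => ui.
(* The support of [u], in increasing order, picks out the subsequence. *)
pose r := [seq k <- enum 'I_(size S) | u k != 0].
pose T := [seq nth 0%R S k | k : 'I_(size S) <- r].
have sT : subseq T S.
  have := map_subseq (fun k : 'I_(size S) => nth 0%R S k)
                       (filter_subseq (fun k => u k != 0) (enum 'I_(size S))).
  by rewrite [X in subseq _ X](map_comp (nth 0%R S) val) val_enum_ord
              -/(mkseq _ _) mkseq_nth.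
case: (hzs (size T)); last first.
  exists T; split=> //; exists [seq u k | k <- r]; split.
  - by rewrite !size_map.
  - apply/allP=> x /mapP[k]; rewrite mem_filter => /andP[uk _] ->.
    have := uP k; rewrite (negPf uk) /= => /andP[lt co].
    by apply/andP; split; [rewrite lt0n uk ltnW | exact: co].
  - rewrite zip_map big_map big_filter /=.
    rewrite [LHS](_ : _ = \sum_(k < size S) nth 0 S k *+ u k)%R; last first.
      rewrite big_mkcond big_enum /=; apply: eq_bigr => k _.
      by case: (u k) => //; rewrite mulr0n.
    (* The group product is addition by conversion. *)
    exact: prod1.
apply/andP; split.
  rewrite size_map -has_predT; apply/hasP; exists i => //.
  by rewrite mem_filter ui mem_enum.
apply: leq_trans (size_subseq sT) _; rewrite sS.
apply: leq_trans (double_leq_expn _ (odd_prime_gt2 p_odd p_pr)).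
by rewrite -addnn leq_add2l.
Qed.

Local Close Scope group_scope.

Theorem theorem6p3 (p a b : nat) (S : seq ('Z_(p ^ a) * 'Z_(p ^ b)))
    (hp : prime p) (hodd : odd p) (hb : 0 < b) (hba : b <= a)
    (hS : size S = a + b)
    (hzs : forall n : nat, 1 <= n <= p ^ a ->
       ~ has_weighted_zero_sum_subseq (weights p a) S n) :
  (forall j : nat, 1 <= j <= a -> 1 <= delta j S) /\
  \sum_(1 <= j < a.+1) delta j S = a + b.
Proof.
have p1 := prime_gt1 hp; have a_gt0 := leq_trans hb hba.
have pn : p %| p ^ a by rewrite -{1}(expn1 p) dvdn_exp2l.
have n_gt0 : 0 < p ^ a by rewrite expn_gt0 (ltnW p1).
have gt1 c : 0 < c -> 1 < p ^ c by move=> c0; rewrite -(exp1n c) ltn_exp2r.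
have abT : abelian [set: 'Z_(p ^ a) * 'Z_(p ^ b)].
  by apply/centsP=> y _ z _; exact: addrC.
have xn y := expg_Zp_pair y hp hb hba.
have free := weighted_zero_sum_free hp hodd hba hS hzs.
have cardT : #|{: 'Z_(p ^ a) * 'Z_(p ^ b)}| = (p ^ #|'I_(size S)|)%N.
  by rewrite card_ord hS card_prod !card_ord !Zp_cast ?gt1 // expnD.
split=> [j /andP[j1 ja]|].
  rewrite -has_count; apply/hasP.
  have [||i oi] := free_order_exists hp abT n_gt0 pn
    (fun i : 'I_(size S) => xn (nth 0%R S i)) free (j := j.-1) hodd cardT.
  - move=> m; rewrite -addnn expnD; apply: card_Ldiv_Zp_pair.
    by rewrite expn_gt0 (ltnW p1).
  (* [(1, 0)] has order [p ^ a], which exceeds [p ^ j.-1]. *)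
  - exists (1%R, 0%R); rewrite expg_pair; apply/eqP=> -[e1 _].
    have := val_Zp_nat (gt1 a a_gt0) (p ^ j.-1); rewrite modn_small; last first.
      by rewrite ltn_exp2l // prednK.
    rewrite -[LHS]/(val ((1%R : 'Z_(p ^ a)) ^+ (p ^ j.-1))%g) e1 => /esym/eqP.
    by rewrite expn_eq0 eqn0Ngt (ltnW p1).
  exists (nth 0%R S i); first exact: mem_nth.
  by rewrite oi prednK.
have orderS y : y \in S -> exists2 k, #[y]%g = p ^ k & 1 <= k <= a.
  move=> yS; have /(dvdn_pfactor _ _ hp)[k ka ok] : #[y]%g %| p ^ a.
    by rewrite order_dvdn xn.
  exists k => //; rewrite ka andbT lt0n; apply/eqP => k0.
  have iS : index y S < size S by rewrite index_mem.
  (* For the trivial subgroup [card_free_in] allows no index, so no term of [S] is zero. *)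
  have := card_free_in hp abT n_gt0 pn (fun i : 'I_(size S) => xn (nth 0%R S i)) free 1%G.
  rewrite cards1 -(expn0 p) leq_exp2l // leqn0 cards_eq0 => /eqP/setP/(_ (Ordinal iS)).
  by rewrite !inE nth_index // -order_eq1 ok k0.
(* After exchanging the sums, each term counts once, at its own exponent [k]. *)
rewrite -hS -sum1_size.
under eq_bigr do rewrite /delta -sum1_count big_mkcond.
rewrite exchange_big /= !big_seq; apply: eq_bigr => y /orderS[k -> /andP[k1 ka]].
rewrite (bigD1_seq k) ?mem_index_iota ?iota_uniq ?k1 ?ltnS //= eqxx.
rewrite big1 // => l lk; rewrite eqn_exp2l //.
by rewrite eq_sym (negPf lk).
Qed.
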